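(* Let $n\ge 1$ be an integer and let $q\ge 0$ be a real number. Then the polynomial $$B_n(\mathbf{x},\mathbf{y};q)=\sum_{\sigma\in B_n} q^{N(\sigma)}\prod_{i\in \mathcal{DT}_B(\sigma)}x_i\prod_{i\in\mathcal{AT}_B(\sigma)}y_i\ \in\ \mathbb{R}[x_1,\dots,x_n,y_1,\dots,y_n]$$ is stable.
   Context: A polynomial $f\in\mathbb{R}[z_1,\dots,z_m]$ is called (real) stable if $f\equiv 0$ or $f(z_1,\dots,z_m)\ne 0$ whenever all $z_j\in\mathbb{C}$ have strictly positive imaginary part. $B_n$ is the group of signed permutations, i.e. the set of sequences $\sigma=(\sigma_1,\dots,\sigma_n)$ of nonzero integers such that $(|\sigma_1|,\dots,|\sigma_n|)$ is a permutation of $[n]=\{1,\dots,n\}$. Put $\sigma_0=0$. Let $N(\sigma)=|\{i\in[n]:\sigma_i<0\}|$ (with the convention $0^0=1$), and $$\mathcal{DT}_B(\sigma)=\{\max(|\sigma_i|,|\sigma_{i+1}|):0\le i\le n-1,\ \sigma_i>\sigma_{i+1}\},$$ $$\mathcal{AT}_B(\sigma)=\{\max(|\sigma_i|,|\sigma_{i+1}|):0\le i\le n-1,\ \sigma_i<\sigma_{i+1}\}.$$ *)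

(* Defs.v *)
From HB Require Import structures.
From mathcomp Require Import all_boot all_order all_algebra.
From mathcomp Require Import perm reals complex mpoly.

Set Implicit Arguments.
Unset Strict Implicit.
Unset Printing Implicit Defensive.

Import Order.TTheory GRing.Theory Num.Theory.

Local Open Scope ring_scope.

Definition stable (R : realType) (m : nat) (f : {mpoly R[m]}) : Prop :=
  f = 0 \/
  forall z : 'I_m -> R[i], (forall j, 0 < complex.Im (z j)) ->
    (map_mpoly (real_complex R) f).@[z] != 0.

(* The pair (p, e) stands for the sequence whose entry at the 0-based position
   i is (-1)^(e i) * (p i + 1); [sp_wordP] and [sp_word_inj] show that these
   pairs are exactly the signed permutations of {1, ..., n}, without
   repetition. *)
Definition signed_perm (n : nat) : finType := ('S_n * {ffun 'I_n -> bool})%type.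

Definition sp_word (n : nat) (s : signed_perm n) : seq int :=
  [seq (-1) ^+ s.2 i * (s.1 i).+1%:Z | i <- enum 'I_n].

Lemma size_sp_word n (s : signed_perm n) : size (sp_word s) = n.
Proof. by rewrite size_map size_enum_ord. Qed.

Lemma nth_sp_word n (s : signed_perm n) (i : 'I_n) :
  nth 0 (sp_word s) i = (-1) ^+ s.2 i * (s.1 i).+1%:Z.
Proof. by rewrite (nth_map i) ?size_enum_ord // nth_ord_enum. Qed.

Lemma absz_sp_letter (b : bool) (k : nat) : absz ((-1) ^+ b * k%:Z) = k.
Proof. by rewrite abszMsign. Qed.

Lemma sp_word_inj n : injective (@sp_word n).
Proof.
move=> [p e] [p' e'] eqw.
have H i : (-1) ^+ e i * (p i).+1%:Z = (-1) ^+ e' i * (p' i).+1%:Z :> int.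
  by rewrite -(nth_sp_word (p, e)) -(nth_sp_word (p', e')) eqw.
congr pair.
  apply/permP => i; apply/val_inj; apply: succn_inj.
  by rewrite -[LHS](absz_sp_letter (e i)) H absz_sp_letter.
apply/ffunP => i; have := congr1 (fun x : int => x < 0) (H i).
by case: (e i); case: (e' i); rewrite ?expr0 ?expr1 ?mul1r ?mulN1r.
Qed.

Lemma sp_wordP n (w : seq int) :
  perm_eq (map absz w) (iota 1 n) <-> exists s : signed_perm n, w = sp_word s.
Proof.
split=> [pw | [[p e] ->]]; last first.
  apply: uniq_perm; rewrite ?iota_uniq //.
    rewrite -map_comp map_inj_uniq ?enum_uniq // => i j /=.
    by rewrite !absz_sp_letter => -[/val_inj/perm_inj].
  move=> k; rewrite mem_iota -map_comp; apply/mapP/idP => [[i _ ->] | /andP[]].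
    by rewrite /= absz_sp_letter /= add1n ltnS ltn_ord.
  case: k => // k _; rewrite add1n ltnS => ltkn.
  exists (p^-1%g (Ordinal ltkn)); first by rewrite mem_enum.
  by rewrite /= absz_sp_letter permKV.
have sw : size w = n by rewrite -(size_map absz) (perm_size pw) size_iota.
have mw (i : 'I_n) : absz (nth 0%R w i) \in iota 1 n.
  by rewrite -(perm_mem pw) map_f // mem_nth ?sw.
have lt_w (i : 'I_n) : ((absz (nth 0%R w i)).-1 < n)%N.
  by move: (mw i); rewrite mem_iota; case: (absz _) => // k /andP[].
have w_gt0 (i : 'I_n) : (0 < absz (nth 0%R w i))%N.
  by move: (mw i); rewrite mem_iota => /andP[].
have injp : injective (fun i => Ordinal (lt_w i)).
  move=> i j [] /(congr1 succn); rewrite !prednK // => eqa; apply/val_inj/eqP.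
  have uw : uniq (map absz w) by rewrite (perm_uniq pw) iota_uniq.
  rewrite -(nth_uniq 0%N _ _ uw) ?size_map ?sw ?ltn_ord //.
  by rewrite !(nth_map (0 : int)) ?sw ?ltn_ord // eqa.
exists (perm injp, [ffun i : 'I_n => nth 0%R w i < 0]).
apply: (@eq_from_nth _ 0); rewrite ?size_sp_word // sw => k ltkn.
rewrite (nth_sp_word _ (Ordinal ltkn)) /= ffunE permE /= prednK ?w_gt0 //.
  by rewrite -intEsign.
exact: w_gt0 (Ordinal ltkn).
Qed.

(* The letters sigma_0 = 0, sigma_1, ..., sigma_n. *)
Definition sp_letter (n : nat) (s : signed_perm n) (i : nat) : int :=
  nth 0 (0 :: sp_word s) i.

Definition negN (n : nat) (s : signed_perm n) : nat :=
  #|[set i : 'I_n | sp_letter s i.+1 < 0]|.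

Definition edge_top (n : nat) (s : signed_perm n) (i : nat) : nat :=
  maxn (absz (sp_letter s i)) (absz (sp_letter s i.+1)).

Lemma edge_top_bounds n (s : signed_perm n) (i : 'I_n) :
  (1 <= edge_top s i <= n)%N.
Proof.
have letterS (j : 'I_n) : absz (sp_letter s j.+1) = (s.1 j).+1.
  by rewrite [sp_letter _ _]nth_sp_word absz_sp_letter.
rewrite /edge_top letterS leq_max orbT /= geq_max ltn_ord andbT.
case: i => -[|i] lt_in //=.
by rewrite (letterS (Ordinal (ltnW lt_in))) ltn_ord.
Qed.

(* Subsets of {1, ..., n} are coded as {set 'I_n}, where k : 'I_n stands for
   k + 1; no element is lost by [edge_top_bounds]. *)
Definition DT_B (n : nat) (s : signed_perm n) : {set 'I_n} :=
  [set k : 'I_n | [exists i : 'I_n,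
     (sp_letter s i > sp_letter s i.+1) && (edge_top s i == k.+1)]].

Definition AT_B (n : nat) (s : signed_perm n) : {set 'I_n} :=
  [set k : 'I_n | [exists i : 'I_n,
     (sp_letter s i < sp_letter s i.+1) && (edge_top s i == k.+1)]].

(* Among the n + n variables, x_(k+1) is the k-th one and y_(k+1) is the
   (n + k)-th one. *)
Definition B_poly (R : realType) (n : nat) (q : R) : {mpoly R[n + n]} :=
  \sum_(s : signed_perm n)
    q ^+ negN s *: (\prod_(k in DT_B s) 'X_(lshift n k) *
                    \prod_(k in AT_B s) 'X_(rshift n k)).

(* Main.v *)
(* Inserting the letters n+1 and -(n+1) in all places of the words of B_n gives
     B_{n+1} = (y + q x) B_n + (1 + q) x y D B_n,   x = x_{n+1}, y = y_{n+1},
   where D is the sum of all partial derivatives. At a point z of the upper half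
   plane put g(t) = B_n(z + t (1, ..., 1)). By induction all the roots of g lie in
   the lower half plane, so g'(0)/g(0), the sum of the -1/r over the roots r of g,
   has imaginary part <= 0. Hence B_{n+1} / (x y B_n) = 1/x + q/y
   + (1 + q) g'(0)/g(0) has negative imaginary part. *)
Require Import Defs.
From mathcomp Require Import all_boot all_order all_algebra.
From mathcomp Require Import reals mpoly.
From mathcomp Require Import perm complex zify ring lra.

Set Implicit Arguments.
Unset Strict Implicit.
Unset Printing Implicit Defensive.

Import Order.TTheory GRing.Theory Num.Theory.

Local Open Scope ring_scope.

(** * Weights of words, and signed permutations generated by insertion *)

Section Word.
Variables (A : comNzRingType) (q : A) (X Y : nat -> A).

Definition sign_wt (a : int) : A := if a < 0 then q else 1.

Definition edge_wt (a b : int) : A :=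
  let k := maxn (absz a) (absz b) in
  if b < a then X k else if a < b then Y k else 1.

(** The letter before the word is a parameter so that induction can move past the first letter;
    [a = 0] plays the part of sigma_0. *)
Fixpoint word_wt (a : int) (w : seq int) : A :=
  if w is b :: w' then sign_wt b * edge_wt a b * word_wt b w' else 1.

End Word.

Fixpoint ins (a : int) (w : seq int) : seq (seq int) :=
  (a :: w) :: if w is b :: w' then [seq b :: v | v <- ins a w'] else [::].

Fixpoint sp_words (n : nat) : seq (seq int) :=
  if n is m.+1 then
    flatten [seq ins n%:Z w ++ ins (- n%:Z) w | w <- sp_words m]
  else [:: [::]].

Lemma size_ins a w : size (ins a w) = (size w).+1.
Proof. by elim: w => //= b w IHw; rewrite size_map IHw. Qed.

Lemma perm_ins a w v : v \in ins a w -> perm_eq v (a :: w).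
Proof.
elim: w v => [|b w IHw] v /=; first by rewrite inE => /eqP->.
rewrite inE => /predU1P[-> //|/mapP[u /IHw uw ->]].
by rewrite -(perm_cons b) in uw; rewrite (perm_trans uw) // (perm_catCA [:: b] [:: a]).
Qed.

Lemma mem_ins a u v : u ++ a :: v \in ins a (u ++ v).
Proof.
elim: u => [|b u IHu] /=; first by case: v => *; rewrite /= mem_head.
by rewrite inE map_f ?orbT.
Qed.

Lemma perm_iotaS n : perm_eq (iota 1 n.+1) (n.+1 :: iota 1 n).
Proof. by rewrite -{1}[n.+1]addn1 iotaD perm_catC add1n. Qed.

Lemma sp_words_perm n w :
  w \in sp_words n -> perm_eq (map absz w) (iota 1 n).
Proof.
elim: n w => [|n IHn] w; first by rewrite inE => /eqP->.
case/flattenP=> _ /mapP[u /IHn un ->] wu.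
rewrite perm_sym (perm_trans (perm_iotaS n)) // perm_sym.
move: wu; rewrite mem_cat => /orP[] /perm_ins wu;
  by rewrite (perm_trans (perm_map _ wu)) // map_cons ?abszN perm_cons.
Qed.

(** Deleting the letter of modulus [n+1] leaves a word for [n]; reinserting it at its old place
    gives back [w]. *)
Lemma mem_sp_words n w : perm_eq (map absz w) (iota 1 n) -> w \in sp_words n.
Proof.
elim: n w => [|n IHn] w pw.
  by rewrite inE -size_eq0 -(size_map absz) (perm_size pw).
have /mapP[a aw Da] : n.+1 \in map absz w.
  by rewrite (perm_mem pw) mem_iota; lia.
case/splitPr: aw pw => u v pw.
apply/flattenP; exists (ins n.+1%:Z (u ++ v) ++ ins (- n.+1%:Z) (u ++ v)).
  apply/(map_f (fun w => ins n.+1%:Z w ++ ins (- n.+1%:Z) w))/IHn.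
  rewrite -(perm_cons n.+1).
  apply: perm_trans (perm_iotaS n); apply: perm_trans pw.
  by rewrite !map_cat /= -Da perm_sym -cat1s perm_catCA.
have [-> | ->] : a = n.+1%:Z \/ a = - n.+1%:Z by lia.
  by rewrite mem_cat mem_ins.
by rewrite mem_cat mem_ins orbT.
Qed.

Lemma size_sp_words n : size (sp_words n) = (n`! * 2 ^ n)%N.
Proof.
elim: n => //= n IHn; rewrite size_flatten /shape -map_comp.
have -> : map (size \o (fun w => ins n.+1%:Z w ++ ins (- n.+1%:Z) w)) (sp_words n)
    = [seq (2 * n.+1)%N | _ <- sp_words n].
  apply/eq_in_map => w /sp_words_perm/perm_size; rewrite size_map size_iota => sw.
  by rewrite /= size_cat !size_ins sw mul2n addnn.
by rewrite sumnE big_map big_const_seq count_predT iter_addn IHn factS expnS; lia.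
Qed.

(** By counting: the left list has no repetition, lies inside [sp_words n], and both have length n!
    2^n. Hence insertion never produces a word twice. *)
Lemma sp_words_enum n :
  perm_eq [seq sp_word s | s <- enum (signed_perm n)] (sp_words n).
Proof.
have uw : uniq [seq sp_word s | s <- enum (signed_perm n)].
  by rewrite map_inj_uniq ?enum_uniq //; apply: sp_word_inj.
have sub : {subset [seq sp_word s | s <- enum (signed_perm n)] <= sp_words n}.
  by move=> _ /mapP[s _ ->]; apply/mem_sp_words/sp_wordP; exists s.
have le : (size (sp_words n) <= size [seq sp_word s | s <- enum (signed_perm n)])%N.
  rewrite size_sp_words size_map -cardE card_prod card_ffun card_ord card_bool.
  by rewrite -[X in (_ <= X * _)%N]/#|'S_n| card_Sn.
by apply: uniq_perm => //; [apply: leq_size_uniq sub le | apply: (uniq_min_size uw sub le).2].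
Qed.

Lemma sp_words_bound n w a : w \in sp_words n -> a \in w -> (absz a < n.+1)%N.
Proof.
move=> /sp_words_perm pw aw; have := map_f absz aw.
by rewrite (perm_mem pw) mem_iota => /andP[].
Qed.

(** * The recurrence obtained by inserting the largest letter *)

Section Insertion.
Variables (A : comNzRingType) (q : A) (X Y : nat -> A).

Definition B_sum (n : nat) : A := \sum_(w <- sp_words n) word_wt q X Y 0 w.

Definition shiftX (Z : nat -> A) (k : nat) : {poly A} := (Z k)%:P + 'X.

(** The weight along the line [t |-> (X + t, Y + t)]; its derivative at 0 is the operator D applied
    to the weight. *)
Definition word_poly (a : int) (w : seq int) : {poly A} :=
  word_wt q%:P (shiftX X) (shiftX Y) a w.

Lemma word_poly_horner t a w :
  (word_poly a w).[t] = word_wt q (fun k => X k + t) (fun k => Y k + t) a w.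
Proof.
elim: w a => [|b w IHw] a; rewrite /word_poly /= ?hornerE //.
rewrite -/(word_poly b w) IHw /sign_wt /edge_wt /shiftX.
by case: (b < 0); case: (b < a); case: (a < b); rewrite !hornerE.
Qed.

Lemma word_poly_horner0 a w : (word_poly a w).[0] = word_wt q X Y a w.
Proof.
rewrite word_poly_horner; elim: w a => //= b w IHw a.
by rewrite IHw /edge_wt !addr0.
Qed.

(** Product rule at the first edge: as [a != b], its factor is a shifted variable, of derivative
    1. *)
Lemma deriv_word_poly a b w : a != b ->
  (word_poly a (b :: w))^`().[0] = sign_wt q b * (word_wt q X Y b w
    + edge_wt X Y a b * (word_poly b w)^`().[0]).
Proof.
move=> neq_ab; rewrite -word_poly_horner0 /word_poly /= -/(word_poly b w).
have -> : sign_wt q%:P b = (sign_wt q b)%:P by rewrite /sign_wt; case: ifP.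
rewrite -mulrA mul_polyC derivZ hornerZ derivM hornerD !hornerM; congr (_ * _).
have [-> ->] : (edge_wt (shiftX X) (shiftX Y) a b)^`() = 1 /\
    (edge_wt (shiftX X) (shiftX Y) a b).[0] = edge_wt X Y a b.
  rewrite /edge_wt /shiftX; case: ltgtP neq_ab => // _ _;
  by rewrite derivD derivC derivX add0r !hornerE.
by rewrite !hornerE.
Qed.

(** The sign of the letter of larger modulus alone decides between ascent and descent. *)
Lemma edge_wt_maxr a p : (absz p < absz a)%N ->
  edge_wt X Y p a = if 0 < a then Y (absz a) else X (absz a).
Proof.
move=> ltpa; rewrite /edge_wt (maxn_idPr (ltnW ltpa)).
case: (ltP 0 a) => a0.
  by have [-> ->] : (a < p) = false /\ (p < a) = true by split; lia.
by have -> : (a < p) = true by lia.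
Qed.

Lemma edge_wt_maxl a p : (absz p < absz a)%N ->
  edge_wt X Y a p = if 0 < a then X (absz a) else Y (absz a).
Proof.
move=> ltpa; rewrite /edge_wt (maxn_idPl (ltnW ltpa)).
case: (ltP 0 a) => a0; first by have -> : (p < a) = true by lia.
by have [-> ->] : (p < a) = false /\ (a < p) = true by split; lia.
Qed.

(* Inserting a letter [a] of largest modulus [k] between two neighbours replaces
   the factor of the edge joining them by [X k * Y k]; summed over the edges this
   differentiates [word_wt] along the direction (1, ..., 1). *)
Lemma sum_ins (a : int) (k := absz a) p w :
  uniq (p :: w) -> all (fun b => absz b < k)%N (p :: w) ->
  \sum_(v <- ins a w) word_wt q X Y p v
    = sign_wt q a * ((if 0 < a then Y k else X k) * word_wt q X Y p w
      + X k * Y k * (word_poly p w)^`().[0]).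
Proof.
elim: w p => [|b w IHw] p.
  move=> _ /andP[ltpk _]; rewrite big_seq1 /word_poly /= derivC horner0.
  by rewrite edge_wt_maxr // -/k; ring.
rewrite [uniq _]/= inE negb_or => /andP[/andP[neq_pb _] buw] /and3P[ltpk ltbk all_w].
rewrite [ins _ _]/= big_cons big_map.
under eq_bigr do rewrite [word_wt _ _ _ _ _]/=.
rewrite -mulr_sumr IHw ?[all _ _]/= ?ltbk // deriv_word_poly //.
rewrite [word_wt _ _ _ _ _]/= [word_wt _ _ _ _ (b :: w)]/=.
rewrite edge_wt_maxr // edge_wt_maxl // -/k.
by case: (0 < a); ring.
Qed.

Definition B_line (n : nat) : {poly A} := \sum_(w <- sp_words n) word_poly 0 w.

(** In [sum_ins], the last place gives [Y] for [n+1] and [q X] for [-(n+1)]; the other places give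
    [X Y] times the derivative, with sign weights 1 and [q]. *)
Lemma B_sumS n : B_sum n.+1 =
  (Y n.+1 + q * X n.+1) * B_sum n
  + (1 + q) * (X n.+1 * Y n.+1) * (B_line n)^`().[0].
Proof.
rewrite /B_sum /B_line /= big_flatten big_map raddf_sum horner_sum.
rewrite !mulr_sumr -big_split; apply: eq_big_seq => w wn /=.
have uw : uniq (0 :: w).
  apply: (@map_uniq _ _ absz); rewrite /= (perm_uniq (sp_words_perm wn)).
  by rewrite (perm_mem (sp_words_perm wn)) mem_iota iota_uniq.
have bw : all (fun b => absz b < n.+1)%N (0 :: w).
  by apply/andP; split=> //; apply/allP => a; apply: sp_words_bound.
rewrite big_cat !sum_ins ?abszN ?absz_nat // /sign_wt oppr_lt0 oppr_gt0.
have [-> ->] : (n.+1%:Z < 0) = false /\ (0 < n.+1%:Z) = true by split; lia.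
by rewrite /=; ring.
Qed.

End Insertion.

Lemma B_line_horner (A : comNzRingType) (q : A) X Y n t :
  (B_line q X Y n).[t] = B_sum q (fun k => X k + t) (fun k => Y k + t) n.
Proof.
by rewrite horner_sum; apply: eq_bigr => w _; rewrite word_poly_horner.
Qed.

(** * Imaginary parts and nonvanishing on the upper half plane *)

Section UpperHalfPlane.
Variable R : realType.
Local Notation Im := complex.Im.

Lemma ImD (x y : R[i]) : Im (x + y) = Im x + Im y.
Proof. by case: x y => [a b] [c d]. Qed.

Lemma ImN (x : R[i]) : Im (- x) = - Im x.
Proof. by case: x. Qed.

Lemma Im_realM (r : R) (x : R[i]) : Im (real_complex R r * x) = r * Im x.
Proof. by case: x => a b /=; rewrite mul0r addr0. Qed.

Lemma Im_inv (x : R[i]) : 0 < Im x -> Im x^-1 < 0.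
Proof.
case: x => a b /= b_gt0; rewrite oppr_lt0 divr_gt0 //.
by rewrite ltr_wpDl ?sqr_ge0 // exprn_gt0.
Qed.

Lemma logderiv0_Im (p : {poly R[i]}) :
  (forall r, root p r -> Im r < 0) -> Im (p^`().[0] / p.[0]) <= 0.
Proof.
have [s ->] := closed_field_poly_normal p; set c := lead_coef p.
have [->|c0] := eqVneq c 0.
  by rewrite scale0r linear0 horner0 mul0r.
rewrite derivZ !hornerZ -mulf_div divff // mul1r => rootp.
have {}rootp r : r \in s -> Im r < 0.
  by move=> rs; apply: rootp; rewrite rootZ // root_prod_XsubC.
(* The induction on the roots also carries nonvanishing at 0, which allows the factor ['X - r] to be
   split off; it contributes [(- r)^-1]. *)
suff [] : (\prod_(z <- s) ('X - z%:P)).[0] != 0 /\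
  Im ((\prod_(z <- s) ('X - z%:P))^`().[0] / (\prod_(z <- s) ('X - z%:P)).[0]) <= 0
  by [].
elim: s rootp => [|r s IHs] rootp.
  by rewrite big_nil -polyC1 derivC horner0 hornerC mul0r oner_neq0.
have [|P0 leP] := IHs; first by move=> z zs; rewrite rootp // inE zs orbT.
have r_lt0 : Im r < 0 by rewrite rootp ?mem_head.
have r0 : r != 0 by apply: contraTneq r_lt0 => ->; rewrite /= ltxx.
rewrite big_cons; set P := \prod_(_ <- _) _ in P0 leP *.
rewrite !derivE !hornerE subr0 mul1r; split; first by rewrite mulf_neq0 ?oppr_eq0.
have -> : (P.[0] + - r * P^`().[0]) / (- r * P.[0]) = (- r)^-1 + P^`().[0] / P.[0].
  by field; rewrite P0 r0.
rewrite ImD; have := @Im_inv (- r); rewrite ImN oppr_gt0 => /(_ r_lt0); lra.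
Qed.

(** The induction is over all [X] and [Y] at once, since its hypothesis is needed at shifted
    points. *)
Lemma B_sum_neq0 (q : R) X Y n : 0 <= q ->
  (forall k, 0 < Im (X k)) -> (forall k, 0 < Im (Y k)) ->
  B_sum (real_complex R q) X Y n != 0.
Proof.
move=> q_ge0; elim: n X Y => [|n IHn] X Y Xpos Ypos.
  by rewrite /B_sum big_seq1 /= oner_neq0.
set qC := real_complex R q.
have B0 := IHn _ _ Xpos Ypos; rewrite -/qC in B0.
(* A shift by [r] with [Im r >= 0] stays in the upper half plane, so such an [r] is no root. *)
have rootg r : root (B_line qC X Y n) r -> Im r < 0.
  rewrite ltNge; apply: contraL => r_ge0; rewrite rootE B_line_horner.
  by apply: IHn => k; rewrite ImD ltr_wpDr.
have gE : (B_line qC X Y n).[0] = B_sum qC X Y n.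
  by rewrite horner_sum; apply: eq_bigr => w _; rewrite word_poly_horner0.
have := logderiv0_Im rootg; rewrite gE B_sumS.
set D := _^`().[0]; set B := B_sum _ _ _ _ in B0 *; set x := X _; set y := Y _.
have x0 : x != 0 by apply: contraTneq (Xpos n.+1) => e; rewrite -/x e /= ltxx.
have y0 : y != 0 by apply: contraTneq (Ypos n.+1) => e; rewrite -/y e /= ltxx.
have -> : (y + qC * x) * B + (1 + qC) * (x * y) * D
    = x * y * B * (x^-1 + qC * y^-1 + (1 + qC) * (D / B)).
  by field; rewrite x0 y0 B0.
move=> leD; rewrite !mulf_neq0 //.
(* Strictness comes from [x^-1]; the other terms have imaginary part [<= 0]. *)
have : Im (x^-1 + qC * y^-1 + (1 + qC) * (D / B)) < 0.
  rewrite !ImD mulrDl mul1r ImD !Im_realM.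
  have := Im_inv (Xpos n.+1); rewrite -/x.
  have := mulr_ge0_le0 q_ge0 (ltW (Im_inv (Ypos n.+1))); rewrite -/y.
  have := mulr_ge0_le0 q_ge0 leD.
  lra.
by apply: contraTneq => ->; rewrite /= ltxx.
Qed.

End UpperHalfPlane.

(** * From word weights to the monomials of signed permutations *)

Lemma word_wtE (A : comNzRingType) (q : A) X Y a w :
  word_wt q X Y a w = \prod_(i < size w)
    (sign_wt q (nth 0 w i) * edge_wt X Y (nth 0 (a :: w) i) (nth 0 w i)).
Proof.
by elim: w a => [|b w IHw] a; rewrite ?big_ord0 // big_ord_recl /= IHw.
Qed.

Section SignedPerm.
Variables (n : nat) (s : signed_perm n).

Lemma absz_sp_letter_neq i j : (i <= n)%N -> (j <= n)%N -> i != j ->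
  absz (sp_letter s i) != absz (sp_letter s j).
Proof.
move=> lein lejn; apply: contra_neq => eq_ij; apply/eqP.
have uw : uniq (map absz (0 :: sp_word s)).
  have pw : perm_eq (map absz (sp_word s)) (iota 1 n) by apply/sp_wordP; exists s.
  by rewrite /= (perm_uniq pw) (perm_mem pw) mem_iota iota_uniq.
have sz : size (0 :: sp_word s) = n.+1 by rewrite /= size_sp_word.
rewrite -(nth_uniq 0%N _ _ uw) ?size_map ?sz ?ltnS //.
by rewrite !(nth_map (0 : int)) ?sz ?ltnS //; apply/eqP.
Qed.

(* A letter of larger modulus than both its neighbours tops one descent and one
   ascent, so no letter tops two edges of the same kind. *)
Lemma edge_top_inj (i j : 'I_n) :
  (sp_letter s i.+1 < sp_letter s i) = (sp_letter s j.+1 < sp_letter s j) ->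
  edge_top s i = edge_top s j -> i = j.
Proof.
wlog lt_ij : i j / (i < j)%N.
  move=> IH dij tij; case: (ltngtP i j) => [ltij | ltji | /val_inj //].
    exact: IH.
  by apply/esym/IH.
have ltj := ltn_ord j; rewrite /edge_top => dij tij.
have N k l := @absz_sp_letter_neq k l.
have N1 := N i i.+1 ltac:(lia) ltac:(lia) ltac:(lia).
have N2 := N j j.+1 ltac:(lia) ltac:(lia) ltac:(lia).
have N3 := N i j ltac:(lia) ltac:(lia) ltac:(lia).
have N4 := N i j.+1 ltac:(lia) ltac:(lia) ltac:(lia).
have N5 := N i.+1 j.+1 ltac:(lia) ltac:(lia) ltac:(lia).
have [eji | neji] := eqVneq (j : nat) i.+1.
  by rewrite eji in dij tij N2 N3 N4 N5; lia.
have N6 := N i.+1 j ltac:(lia) ltac:(lia) ltac:(lia).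
lia.
Qed.

(** Word weights multiply over positions, [DT_B] and [AT_B] over sets of tops; injectivity ensures
    that no factor is lost when passing to the set. *)
Lemma prod_edge_top (A : comNzRingType) (Z : nat -> A) (P : pred 'I_n) :
  {in P &, forall i j : 'I_n, edge_top s i = edge_top s j -> i = j} ->
  \prod_(i | P i) Z (edge_top s i) =
  \prod_(k in [set k : 'I_n | [exists i, P i && (edge_top s i == k.+1)]]) Z k.+1.
Proof.
move=> injP.
have lt_t (i : 'I_n) : ((edge_top s i).-1 < n)%N.
  by have := edge_top_bounds s i; lia.
pose t i := Ordinal (lt_t i).
have tE i : (t i).+1 = edge_top s i.
  by rewrite /= prednK //; have := edge_top_bounds s i; lia.
have -> : [set k : 'I_n | [exists i, P i && (edge_top s i == k.+1)]] = t @: P.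
  apply/setP => k; rewrite inE; apply/existsP/imsetP => [[i /andP[Pi]] | [i Pi ->]].
    by rewrite -tE eqSS => /eqP/val_inj <-; exists i.
  by exists i; rewrite tE eqxx andbT.
rewrite big_imset /=; first by apply: eq_bigr => i _; rewrite -[RHS]/(Z (t i).+1) tE.
by move=> i j Pi Pj /(congr1 (fun k : 'I_n => k.+1)); rewrite !tE; apply: injP.
Qed.

Lemma word_wt_sp_word (A : comNzRingType) (q : A) X Y :
  word_wt q X Y 0 (sp_word s) =
  q ^+ negN s * (\prod_(k in DT_B s) X k.+1 * \prod_(k in AT_B s) Y k.+1).
Proof.
rewrite word_wtE size_sp_word big_split /=; congr (_ * _).
  rewrite /sign_wt -big_mkcond /= prodr_const; congr (_ ^+ _).
  by apply: eq_card => i; rewrite inE.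
rewrite /DT_B /AT_B -!prod_edge_top.
(* Both products are extended by 1 to all positions and compared edge by edge. *)
- rewrite [X in _ = X * _]big_mkcond [X in _ = _ * X]big_mkcond -big_split /=.
  apply: eq_bigr => i _; rewrite /edge_wt -/(sp_letter s i) -/(edge_top s i).
  by case: ltgtP; rewrite ?mul1r ?mulr1.
- by move=> i j Pi Pj; apply: edge_top_inj; move: Pi Pj; rewrite !unfold_in; lia.
- by move=> i j Pi Pj; apply: edge_top_inj; move: Pi Pj; rewrite !unfold_in; lia.
Qed.

End SignedPerm.

Lemma B_sum_signed_perm (A : comNzRingType) (q : A) X Y n :
  B_sum q X Y n = \sum_(s : signed_perm n) q ^+ negN s *
    (\prod_(k in DT_B s) X k.+1 * \prod_(k in AT_B s) Y k.+1).
Proof.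
rewrite /B_sum -(perm_big _ (sp_words_enum n)) big_map big_enum /=.
by apply: eq_bigr => s _; rewrite word_wt_sp_word.
Qed.

(** * Evaluation of the polynomial and stability *)

Lemma B_poly_eval (R : realType) (S : comNzRingType) (f : {rmorphism R -> S})
    n (q : R) (z : 'I_(n + n) -> S) :
  (map_mpoly f (B_poly n q)).@[z] = \sum_(s : signed_perm n) f q ^+ negN s *
    (\prod_(k in DT_B s) z (lshift n k) * \prod_(k in AT_B s) z (rshift n k)).
Proof.
rewrite (raddf_sum (map_mpoly f)) (raddf_sum (meval z)); apply: eq_bigr => s _.
rewrite -[LHS]/((map_mpoly f (_ *: _)).@[z]) map_mpolyZ mevalZ rmorphXn !rmorphM !rmorph_prod.
by congr (_ * (_ * _)); apply: eq_bigr => k _;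
  rewrite -[LHS]/((map_mpoly f 'X_[_]).@[z]) map_mpolyX mevalXU.
Qed.

Theorem theorem3p9 (R : realType) (n : nat) (q : R) :
  (1 <= n)%N -> 0 <= q -> stable (B_poly n q).
Proof.
case: n => // n _ q_ge0; right => z z_pos.
(* Index [k] stands for the ordinal [k - 1]; outside the range [inord] defaults to 0, so every [X k]
   and [Y k] is a coordinate of [z] and lies in the upper half plane. *)
pose X k := z (lshift n.+1 (inord k.-1)); pose Y k := z (rshift n.+1 (inord k.-1)).
suff -> : (map_mpoly (real_complex R) (B_poly n.+1 q)).@[z] =
    B_sum (real_complex R q) X Y n.+1 by apply: B_sum_neq0 => // k; apply: z_pos.
rewrite B_sum_signed_perm [LHS]B_poly_eval; apply: eq_bigr => s _.
by congr (_ * (_ * _)); apply: eq_bigr => k _; rewrite /X /Y inord_val.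
Qed.
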